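(* Let $X(2,2)_+=\{x\in\mathbb{R}^4: x_1^2+x_2^2-x_3^2-x_4^2=1\}$ and let $\mathscr{D}=\{x^{(i)}: 1\leq i\leq n\}$ be a list of $n$ points of $X(2,2)_+(\mathbb{Q})=X(2,2)_+\cap\mathbb{Q}^4$. For integers $\ell\geq 1$ define $$\varphi_\ell(x)=(x_1+\sqrt{-1}\,x_2)^{-\ell},\qquad x\in X(2,2)_+.$$ Suppose $f:\mathscr{D}\to\mathbb{Q}$ is not constant and that $\varphi_1|_{\mathscr{D}}$ is injective. Then one can choose coefficients $a_\ell$ in the number field $\mathbb{Q}(\sqrt{-1})$, $2\leq\ell\leq n+1$, such that the function $$W_{f,\mathscr{D}}=\sum_{2\leq\ell\leq n+1}a_\ell\varphi_\ell : X(2,2)_+\to\mathbb{C}$$ is analytic, square integrable, $K$-finite, and satisfies $W_{f,\mathscr{D}}(x)=f(x)$ for all $x\in\mathscr{D}$.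
   Context: $X(2,2)_+$ is identified with $\mathrm{SO}(2,2)^\circ/\mathrm{SO}(1,2)^\circ$, where $^\circ$ denotes the identity component; $\mathrm{SO}(2,2)^\circ$ acts linearly on $X(2,2)_+\subset\mathbb{R}^4$. $K=\mathrm{SO}(2)\times\mathrm{SO}(2)$ is the (block diagonal) maximal compact subgroup of $\mathrm{SO}(2,2)^\circ$, acting on functions by $(k\cdot\psi)(x)=\psi(k^{-1}x)$; a function is $K$-finite if its $K$-translates span a finite-dimensional space. Square integrable means with respect to the $\mathrm{SO}(2,2)^\circ$-invariant measure on $X(2,2)_+$. *)

(* Defs.v *)
From HB Require Import structures.
From mathcomp Require Import all_boot all_order all_algebra.
From mathcomp Require Import all_classical all_reals all_analysis.
From mathcomp Require Export complex.

Set Implicit Arguments.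
Unset Strict Implicit.
Unset Printing Implicit Defensive.

Import Order.TTheory GRing.Theory Num.Theory.
Import numFieldNormedType.Exports.

Local Open Scope classical_set_scope.
Local Open Scope complex_scope.
Local Open Scope ring_scope.

(* Points of R^4 are column vectors; the informal coordinates x_1, ..., x_4
   are x 0 0, x 1 0, x 2 0, x 3 0 (ordinals are indexed from 0).  Functions on
   X22 are represented by functions on R^4; every notion below only depends on
   their restriction to X22. *)

Definition X22 (R : realType) : set 'cV[R]_4 :=
  [set x | x 0 0 ^+ 2 + x 1 0 ^+ 2 - x 2 0 ^+ 2 - x 3 0 ^+ 2 = 1].

Definition X22Q (R : realType) : set 'cV[R]_4 :=
  @X22 R `&` [set x | exists q : 'cV[rat]_4, x = map_mx ratr q].

Definition phi (R : realType) (l : nat) (x : 'cV[R]_4) : R[i] :=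
  (x 0 0 +i* x 1 0) ^- l.

Definition gaussian_rational (R : realType) : set R[i] :=
  [set z | exists p q : rat, z = ratr p +i* ratr q].

Definition Wfun (R : realType) (n : nat) (a : nat -> R[i]) (x : 'cV[R]_4) :
    R[i] :=
  \sum_(2 <= l < n.+2) a l * phi l x.

Definition J22 (R : realType) : 'M[R]_4 :=
  block_mx (1%:M : 'M[R]_2) 0 0 (- 1%:M : 'M[R]_2).

Definition SO22 (R : realType) : set 'M[R]_4 :=
  [set g | g^T *m J22 R *m g = J22 R /\ \det g = 1].

Definition SO22o (R : realType) : set 'M[R]_4 :=
  connected_component (@SO22 R) 1%:M.

Definition SO2 (R : realType) : set 'M[R]_2 :=
  [set k | k^T *m k = 1%:M /\ \det k = 1].

Definition SO2xSO2 (R : realType) : set 'M[R]_4 :=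
  [set k | exists k1 k2 : 'M[R]_2,
    [/\ SO2 k1, SO2 k2 & k = block_mx k1 0 0 k2]].

(* The translates of psi span a finite-dimensional space of functions on X22:
   they all lie in the span of finitely many functions e_0, ..., e_{m-1}. *)
Definition K_finite (R : realType) (psi : 'cV[R]_4 -> R[i]) : Prop :=
  exists (m : nat) (e : 'I_m -> 'cV[R]_4 -> R[i]),
    forall k, SO2xSO2 k -> exists c : 'I_m -> R[i],
      forall x, X22 x -> psi (invmx k *m x) = \sum_j c j * e j x.

(* Degree k part of the power series sum_alpha c_alpha h^alpha in n
   variables. *)
Definition homog_part (R : realType) (n : nat) (c : ('I_n -> nat) -> R)
    (h : 'cV[R]_n) (k : nat) : R :=
  \sum_(a : {ffun 'I_n -> 'I_k.+1} | (\sum_i (a i : nat))%N == k)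
     c (fun i => a i : nat) * \prod_i h i 0 ^+ a i.

Definition homog_part_abs (R : realType) (n : nat) (c : ('I_n -> nat) -> R)
    (h : 'cV[R]_n) (k : nat) : R :=
  \sum_(a : {ffun 'I_n -> 'I_k.+1} | (\sum_i (a i : nat))%N == k)
     `|c (fun i => a i : nat) * \prod_i h i 0 ^+ a i|.

Definition real_analytic_at (R : realType) (n : nat) (F : 'cV[R]_n -> R)
    (p : 'cV[R]_n) : Prop :=
  exists (c : ('I_n -> nat) -> R) (r : R), 0 < r /\
    forall h : 'cV[R]_n, `|h| < r ->
      cvgn (series (homog_part_abs c h)) /\
      series (homog_part c h) @ \oo --> F (p + h).

(* A function on an embedded analytic submanifold X of R^n is analytic when it
   is locally the restriction of an analytic function of the ambient space. *)
Definition real_analytic_on (R : realType) (n : nat) (X : set 'cV[R]_n)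
    (F : 'cV[R]_n -> R) : Prop :=
  forall p, X p -> exists G : 'cV[R]_n -> R,
    real_analytic_at G p /\ \forall y \near p, X y -> G y = F y.

Definition analytic_on (R : realType) (n : nat) (X : set 'cV[R]_n)
    (F : 'cV[R]_n -> R[i]) : Prop :=
  real_analytic_on X (fun x => complex.Re (F x)) /\
  real_analytic_on X (fun x => complex.Im (F x)).

(* R^n with its Borel sigma-algebra. *)
Definition borel_cV (R : realType) (n : nat) : measurableType _ :=
  g_sigma_algebraType (@open 'cV[R]_n).

(* mu restricted to X22 is a nonzero SO(2,2)^o-invariant Radon measure; such a
   measure exists and is unique up to a positive scalar. *)
Definition invariant_measure (R : realType)
    (mu : {measure set (borel_cV R 4) -> \bar R}) : Prop :=
  [/\ mu (@X22 R) != 0%E,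
      forall C : set 'cV[R]_4, compact C -> C `<=` @X22 R -> (mu C < +oo)%E
    & forall (g : 'M[R]_4) (A : set (borel_cV R 4)),
        SO22o g -> measurable A -> A `<=` @X22 R ->
        mu [set g *m x | x in (A : set 'cV[R]_4)] = mu A].

Definition square_integrable (R : realType)
    (mu : {measure set (borel_cV R 4) -> \bar R})
    (psi : 'cV[R]_4 -> R[i]) : Prop :=
  [/\ measurable_fun (@X22 R : set (borel_cV R 4))
        ((fun x => complex.Re (psi x)) : borel_cV R 4 -> R),
      measurable_fun (@X22 R : set (borel_cV R 4))
        ((fun x => complex.Im (psi x)) : borel_cV R 4 -> R)
    & (\int[mu]_(x in (@X22 R : set (borel_cV R 4)))
         (ComplexField.Normc.normc (psi x) ^+ 2)%:E < +oo)%E].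

(* Main.v *)
Require Import Defs.
From HB Require Import structures.
From mathcomp Require Import all_boot all_order all_algebra.
From mathcomp Require Import all_classical all_reals all_analysis.
From mathcomp Require Import measurable_realfun zify ring lra.

(* Write z = x_1 + i x_2, so that |z| >= 1 on X22, and let P interpolate the
   values f(x) z^2 at the distinct nodes 1/z: the required function is
   W = Q(1/z) with Q = X^2 P, and its coefficients are Gaussian rationals
   because the nodes are.

   SO(2) x SO(2) multiplies z by a scalar, whence K-finiteness.  Horner's rule
   builds Q(1/z) by adding constants and dividing by z, and both operations
   preserve complex power series whose coefficients and remainders are bounded
   geometrically.

   For square integrability, identify X22 with SL_2(R); the upper triangular
   matrices, acting on the left, lie in SO(2,2)^o.  In the Iwasawa coordinates
   translates of one compact tile cover {|z|^2 <= 4^k}, and O(8^k) of them are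
   enough, so any invariant measure gives this set mass O(8^k).  On the layer
   |z|^2 ~ 4^k one has |W|^2 = O(|z|^-4) = O(16^-k), and the sum of
   8^k 16^-k converges. *)

Set Implicit Arguments.
Unset Strict Implicit.
Unset Printing Implicit Defensive.

Import Order.TTheory GRing.Theory Num.Theory.
Import numFieldNormedType.Exports.
Import ComplexField.Normc.

Local Open Scope classical_set_scope.
Local Open Scope complex_scope.
Local Open Scope ring_scope.

(** * Interpolation over the Gaussian rationals *)

(** Newton's scheme: a new node is corrected by a multiple of [N], which vanishes at the earlier
    nodes and so does not disturb them. Values depend on the node alone, so a repeated node is
    already served. *)
Lemma newton_interpolation (F : fieldType) (s : seq F) (v : F -> F) :
  exists2 P : {poly F}, (size P <= size s)%N & {in s, forall y, P.[y] = v y}.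
Proof.
elim: s => [|x s [P szP Pv]]; first by exists 0; rewrite ?size_poly0.
have [xs|xs] := boolP (x \in s).
  exists P; first exact: leqW.
  by move=> y; rewrite inE => /predU1P[->|]; exact: Pv.
pose N := \prod_(y <- s) ('X - y%:P).
have N0 : N.[x] != 0 by rewrite -[_ == 0]/(root N x) root_prod_XsubC.
exists (P + ((v x - P.[x]) / N.[x]) *: N).
  rewrite (leq_trans (size_polyD _ _))// geq_max leqW//=.
  by rewrite (leq_trans (size_scale_leq _ _))// size_prod_XsubC.
move=> y; rewrite inE => /predU1P[->|ys]; rewrite hornerD hornerZ.
  by rewrite divfK// addrC subrK.
have /eqP -> : N.[y] == 0 by rewrite -[_ == 0]/(root N y) root_prod_XsubC.
by rewrite mulr0 addr0 Pv.
Qed.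

(** The embedding of Q(i); interpolation takes place in [rat[i]] and is transported along it. *)
Definition ratrC (R : realType) (z : rat[i]) : R[i] :=
  ratr (complex.Re z) +i* ratr (complex.Im z).

Lemma ratrC_is_zmod_morphism (R : realType) : zmod_morphism (@ratrC R).
Proof. by move=> [a b] [c d]; rewrite /ratrC/= !rmorphB. Qed.

Lemma ratrC_is_monoid_morphism (R : realType) : monoid_morphism (@ratrC R).
Proof.
split; first by rewrite /ratrC/= rmorph1 rmorph0.
by move=> [a b] [c d]; rewrite /ratrC/= rmorphB rmorphD !rmorphM.
Qed.

HB.instance Definition _ (R : realType) :=
  GRing.isZmodMorphism.Build _ _ (@ratrC R) (@ratrC_is_zmod_morphism R).
HB.instance Definition _ (R : realType) :=
  GRing.isMonoidMorphism.Build _ _ (@ratrC R) (@ratrC_is_monoid_morphism R).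

(** * The coordinate z and its modulus *)

Lemma normc_ge0 (R : rcfType) (u : R[i]) : 0 <= normc u.
Proof. by case: u => a b; exact: sqrtr_ge0. Qed.

Lemma normc_gt0 (R : rcfType) (u : R[i]) : u != 0 -> 0 < normc u.
Proof.
move=> u0; rewrite lt_def normc_ge0 andbT.
by apply: contra_neq u0; exact: eq0_normc.
Qed.

Definition zcoord (R : realType) (x : 'cV[R]_4) : R[i] := x 0 0 +i* x 1 0.

Lemma normc_zcoord (R : realType) (x : 'cV[R]_4) :
  normc (zcoord x) ^+ 2 = x 0 0 ^+ 2 + x 1 0 ^+ 2.
Proof. by rewrite sqr_sqrtr// addr_ge0 ?sqr_ge0. Qed.

Lemma normc_zcoord_ge1 (R : realType) (x : 'cV[R]_4) :
  X22 x -> 1 <= normc (zcoord x) ^+ 2.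
Proof. by rewrite normc_zcoord /X22/=; nra. Qed.

Lemma zcoord_neq0 (R : realType) (x : 'cV[R]_4) : X22 x -> zcoord x != 0.
Proof.
move=> /normc_zcoord_ge1; apply: contraTneq => ->.
by rewrite normc0 expr0n/= ler10.
Qed.

(** The factor ['X^2] accounts for the sum starting at 2, and [size P <= n] for its ending at n +
    1. *)
Lemma Wfun_horner (R : realType) (n : nat) (P : {poly R[i]}) (x : 'cV[R]_4) :
  (size P <= n)%N ->
  Wfun n (fun l => P`_(l - 2)) x = ('X^2 * P).[(zcoord x)^-1].
Proof.
move=> szP; rewrite hornerM hornerXn (horner_coef_wide _ szP) mulr_sumr.
rewrite /Wfun -{1}[2%N]add0n big_addn -addn2 addnK big_mkord.
apply: eq_bigr => i _.
by rewrite addnK /phi -exprVn -/(zcoord x) exprD mulrA mulrC.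
Qed.

(** * Topology and Borel sets of column vectors *)

Lemma continuous_mx (R : realType) (T : topologicalType) (m n : nat)
    (F : T -> 'M[R]_(m, n)) :
  (forall i j, continuous (fun t => F t i j)) -> continuous F.
Proof.
move=> cF t; apply/cvgrPdist_lt => e e0.
have H : \forall s \near t, forall ij : 'I_m * 'I_n,
    `|F t ij.1 ij.2 - F s ij.1 ij.2| < e.
  by apply: filter_forall => -[i j]; have /cvgrPdist_lt/(_ _ e0) := cF i j t.
apply: filterS H => s Hs.
rewrite /Num.norm/= mx_normrE; apply/bigmax_ltP; split=> // -[i j] _ /=.
by rewrite !mxE; exact: (Hs (i, j)).
Qed.

Lemma continuous_mulmxr (R : realType) (m n p : nat) (A : 'M[R]_(m, n)) :
  continuous (fun B : 'M[R]_(n, p) => A *m B).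
Proof.
apply: continuous_mx => i j.
rewrite (_ : (fun B => _) = fun B : 'M[R]_(n, p) => \sum_k A i k * B k j);
  last by apply/funext => B; rewrite mxE.
apply: continuous_big => [|k _]; first exact: add_continuous.
move=> B.
apply: (@continuousM R _ (cst (A i k)) (fun B : 'M[R]_(n, p) => B k j)).
  exact: cst_continuous.
exact: coord_continuous.
Qed.

(** Reduces to Heine-Borel for row vectors: [A] is the image of a compact set under
    transposition. *)
Lemma bounded_closed_compact_cV (R : realType) (n : nat) (A : set 'cV[R]_n)
    (M : R) :
  0 <= M -> (forall x i, A x -> `|x i 0| <= M) -> closed A -> compact A.
Proof.
move=> M0 AM Acl.
have ctr m p : continuous (fun B : 'M[R]_(m, p) => B^T).
  apply: continuous_mx => i j.
  rewrite (_ : (fun B => _) = fun B : 'M[R]_(m, p) => B j i);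
    last by apply/funext => B; rewrite mxE.
  exact: coord_continuous.
have -> : A = trmx @` [set r : 'rV[R]_n | A r^T].
  apply/seteqP; split => [x Ax|_ [r Ar <-]//].
  by exists x^T; rewrite /= trmxK.
apply: continuous_compact; first exact/continuous_subspaceT/ctr.
apply: bounded_closed_compact; last first.
  by apply: preimage_closed => // r _; exact: ctr.
exists M; split=> [|y My r]; first exact: num_real.
move=> /= Ar; apply: le_trans (ltW My).
rewrite /Num.norm/= mx_normrE; apply/bigmax_leP.
split=> [//|[i j] _/=]; by have := AM _ j Ar; rewrite mxE ord1.
Qed.

Lemma closed_measurable_cV (R : realType) (n : nat) (A : set (borel_cV R n)) :
  closed (A : set 'cV[R]_n) -> measurable A.
Proof.
move=> Acl; rewrite -(setCK A); apply: measurableC.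
by apply: sub_sigma_algebra; exact: closed_openC.
Qed.

Lemma continuous_measurable_cV (R : realType) (n : nat) (D : set (borel_cV R n))
    (F : borel_cV R n -> R) :
  continuous (F : 'cV[R]_n -> R) -> measurable D -> measurable_fun D F.
Proof.
move=> cF mD; apply: (measurability _ (RGenOpens.measurableE R)).
move=> _ [_ [a [b ->] <-]]; apply: measurableI => //.
apply: sub_sigma_algebra; apply: open_comp => [x _|]; first exact: cF.
exact: interval_open.
Qed.

(** * Covering by translates of a compact tile *)

(* In the coordinates a = x_1+x_3, b = x_2+x_4, c = x_4-x_2, d = x_1-x_3, the
   quadric X22 is ad - bc = 1 and this matrix acts on [[a, b], [c, d]] by left
   multiplication by [[s, v], [0, t]]. *)
Definition iwasawa (R : realType) (s t v : R) : 'M[R]_4 :=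
  \matrix_(i, j) nth 0 (nth [::]
    [:: [:: (s + t) / 2; - v / 2; (s - t) / 2; v / 2];
        [:: v / 2; (s + t) / 2; - v / 2; (s - t) / 2];
        [:: (s - t) / 2; - v / 2; (s + t) / 2; v / 2];
        [:: v / 2; (s - t) / 2; - v / 2; (s + t) / 2]] i) j.

Lemma iwasawaE (R : realType) (s t v : R) (x : 'cV[R]_4) :
  let y := iwasawa s t v *m x in
  [/\ y 0 0 = ((s + t) * x 0 0 - v * x 1 0 + (s - t) * x 2 0 + v * x 3 0) / 2,
      y 1 0 = (v * x 0 0 + (s + t) * x 1 0 - v * x 2 0 + (s - t) * x 3 0) / 2,
      y 2 0 = ((s - t) * x 0 0 - v * x 1 0 + (s + t) * x 2 0 + v * x 3 0) / 2
    & y 3 0 = (v * x 0 0 + (s - t) * x 1 0 - v * x 2 0 + (s + t) * x 3 0) / 2].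
Proof.
have e1 : lift ord0 ord0 = 1 :> 'I_4 by apply/val_inj.
have e2 : lift ord0 (lift ord0 ord0) = 2 :> 'I_4 by apply/val_inj.
have e3 : lift ord0 (lift ord0 (lift ord0 ord0)) = 3 :> 'I_4 by apply/val_inj.
by split; rewrite !mxE !big_ord_recl big_ord0 !mxE/= e1 e2 e3; ring.
Qed.

Lemma iwasawaM (R : realType) (s t v s' t' v' : R) :
  iwasawa s t v *m iwasawa s' t' v' =
  iwasawa (s * s') (t * t') (s * v' + v * t').
Proof.
apply/matrixP => i j; rewrite !mxE !big_ord_recl big_ord0 !mxE/=.
by case: i j => -[|[|[|[|//]]]] ? [[|[|[|[|//]]]] ?] /=; field.
Qed.

Lemma iwasawa1 (R : realType) : iwasawa 1 1 0 = 1%:M :> 'M[R]_4.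
Proof.
apply/matrixP => i j; rewrite !mxE.
by case: i j => -[|[|[|[|//]]]] ? [[|[|[|[|//]]]] ?] /=; field.
Qed.

Lemma iwasawa_J22 (R : realType) (s t v : R) :
  s * t = 1 -> (iwasawa s t v)^T *m J22 R *m iwasawa s t v = J22 R.
Proof.
move=> st.
have JE : J22 R = \matrix_(i, j)
    nth 0 (nth [::] [:: [:: 1; 0; 0; 0]; [:: 0; 1; 0; 0];
                        [:: 0; 0; -1; 0]; [:: 0; 0; 0; -1]] i) j.
  apply/matrixP => i j; rewrite !mxE.
  by case: splitP => i' ->; rewrite mxE; case: splitP => j' ->;
    rewrite ?mxE; case: i' => -[|[|//]] ?; case: j' => -[|[|//]] ? //=;
    rewrite ?oppr0.
(* Every entry of the product is its target times [s * t]; this form is a plain field identity. *)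
have cst (c e : R) : e = c * (s * t) -> e = c by rewrite st mulr1.
rewrite JE; apply/matrixP => i j; rewrite !mxE !big_ord_recl big_ord0 !mxE.
rewrite !big_ord_recl !big_ord0 !mxE/=.
case: i j => -[|[|[|[|//]]]] ? [[|[|[|[|//]]]] ?] /=; by apply: cst; field.
Qed.

Lemma iwasawa_SO22 (R : realType) (s v : R) :
  0 < s -> SO22 (iwasawa s s^-1 v).
Proof.
move=> s0; split; first by rewrite iwasawa_J22// mulfV ?gt_eqF.
(* J-orthogonality only gives det = 1 or -1, but the matrix is a square. *)
pose q := Num.sqrt s; have q0 : 0 < q by rewrite sqrtr_gt0.
have qq : q * q = s by rewrite -expr2 sqr_sqrtr ?ltW.
(* The corner w of [h] solves q w + w / q = v, as [h *m h] requires. *)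
pose h := iwasawa q q^-1 (v / (q + q^-1)).
have hh : iwasawa s s^-1 v = h *m h.
  rewrite iwasawaM -invfM qq mulrC -mulrDr divfK//.
  by rewrite gt_eqF// addr_gt0 ?invr_gt0.
have JJ : J22 R *m J22 R = 1%:M.
  rewrite /J22 (@mulmx_block _ 2 2 2 2 2 2) !mul0mx !mulmx0 mulmx1 mulmxN.
  by rewrite mulNmx mulmx1 opprK !addr0 add0r -scalar_mx_block.
have hJ : h^T *m J22 R *m h = J22 R by rewrite iwasawa_J22// mulfV ?gt_eqF.
have := congr1 (fun A => \det (J22 R *m A)) hJ.
rewrite JJ !mulmxA det1 !det_mulmx det_tr => detE.
have detJ : \det (J22 R) ^+ 2 = 1 by rewrite expr2 -det_mulmx JJ det1.
rewrite hh det_mulmx -[RHS]detE -expr2 -[LHS]mul1r -[X in X * _ = _]detJ.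
by ring.
Qed.

Lemma iwasawa_SO22o (R : realType) (s v : R) :
  0 < s -> SO22o (iwasawa s s^-1 v).
Proof.
move=> s0.
(* A path from the identity at 0 to the given matrix at 1; the exponentials keep the diagonal
   positive with product 1. *)
pose path (u : R) := iwasawa (expR (u * ln s)) (expR (- (u * ln s))) (u * v).
have path0 : path 0 = 1%:M.
  by rewrite /path !mul0r oppr0 expR0 iwasawa1.
have path1 : path 1 = iwasawa s s^-1 v by rewrite /path !mul1r expRN lnK.
have cpath : continuous path.
  have cl (w : R) : continuous (fun u : R => u * w).
    move=> u; apply: (@continuousM R _ id (cst w)); first exact: cvg_id.
    exact: cst_continuous.
  have c1 : continuous (fun u : R => expR (u * ln s)).
    by move=> u; apply: continuous_comp; [exact: cl|exact: continuous_expR].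
  have c2 : continuous (fun u : R => expR (- (u * ln s))).
    move=> u; apply: (@continuous_comp _ _ _ (fun u : R => - (u * ln s)) expR).
      by apply: continuousN; exact: cl.
    exact: continuous_expR.
  have half (F : R -> R) : continuous F -> continuous (fun u => F u / 2).
    move=> cF u; apply: (@continuousM R _ F (cst 2^-1)); first exact: cF.
    exact: cst_continuous.
  have cD := half _ (fun u => continuousD (c1 u) (c2 u)).
  have cB := half _ (fun u => continuousB (c1 u) (c2 u)).
  have cv := half _ (cl v).
  have cNv := half _ (fun u => continuousN (cl v u)).
  apply: continuous_mx => i j.
  by case: i j => -[|[|[|[|//]]]] ? [[|[|[|[|//]]]] ?];
    under eq_fun do rewrite mxE.
apply: (@connected_component_max _ _ (path @` `[0, 1])).
- by exists 0 => //=; rewrite in_itv/= lexx ler01.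
- by move=> _ [u _ <-]; rewrite /path expRN; exact/iwasawa_SO22/expR_gt0.
- apply: connected_continuous_connected; first exact: segment_connected.
  exact: continuous_subspaceT.
- by exists 1 => //=; rewrite in_itv/= lexx ler01.
Qed.

(* In the coordinates of [iwasawa], these are a^2+b^2, c^2+d^2 and ac+bd. *)
Definition row_top (R : realType) (x : 'cV[R]_4) : R :=
  (x 0 0 + x 2 0) ^+ 2 + (x 1 0 + x 3 0) ^+ 2.

Definition row_bot (R : realType) (x : 'cV[R]_4) : R :=
  (x 3 0 - x 1 0) ^+ 2 + (x 0 0 - x 2 0) ^+ 2.

Definition row_dot (R : realType) (x : 'cV[R]_4) : R :=
  (x 0 0 + x 2 0) * (x 3 0 - x 1 0) + (x 1 0 + x 3 0) * (x 0 0 - x 2 0).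

(** Lagrange's identity (a^2+b^2)(c^2+d^2) = (ad-bc)^2 + (ac+bd)^2 with ad - bc = 1. *)
Lemma row_top_bot (R : realType) (x : 'cV[R]_4) :
  X22 x -> row_top x * row_bot x = 1 + row_dot x ^+ 2.
Proof.
rewrite /X22/= => xX; rewrite -[1](expr1n R 2) -[X in X ^+ 2 + _]xX.
by rewrite /row_top /row_bot /row_dot; ring.
Qed.

(** Both sides are twice the squared Euclidean norm of x, as x_3^2 + x_4^2 = |z|^2 - 1 on the
    quadric. *)
Lemma row_topD_bot (R : realType) (x : 'cV[R]_4) :
  X22 x -> row_top x + row_bot x = 4 * normc (zcoord x) ^+ 2 - 2.
Proof.
rewrite normc_zcoord /X22/= => xX.
rewrite -[X in _ - X]mulr1 -[X in _ - _ * X]xX.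
by rewrite /row_top /row_bot; ring.
Qed.

Lemma iwasawa_X22 (R : realType) (s t v : R) (x : 'cV[R]_4) :
  s * t = 1 -> X22 x -> X22 (iwasawa s t v *m x).
Proof.
rewrite /X22/= => st xX; have [-> -> -> ->] := iwasawaE s t v x.
by rewrite -[RHS]xX -[RHS]mulr1 -[X in _ = _ * X]st; field.
Qed.

(** The rows r_1, r_2 go to s r_1 + v r_2 and t r_2; this gives the present formula and the next. *)
Lemma iwasawa_bot (R : realType) (s t v : R) (x : 'cV[R]_4) :
  row_bot (iwasawa s t v *m x) = t ^+ 2 * row_bot x.
Proof. by rewrite /row_bot; have [-> -> -> ->] := iwasawaE s t v x; field. Qed.

Lemma iwasawa_dot (R : realType) (s t v : R) (x : 'cV[R]_4) :
  s * t = 1 ->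
  row_dot (iwasawa s t v *m x) = row_dot x + t * v * row_bot x.
Proof.
move=> st; rewrite -[row_dot x]mul1r -[X in X * _ + _]st /row_dot /row_bot.
by have [-> -> -> ->] := iwasawaE s t v x; field.
Qed.

Lemma iwasawaK (R : realType) (s t v : R) (x : 'cV[R]_4) :
  s * t = 1 -> iwasawa s t v *m (iwasawa t s (- v) *m x) = x.
Proof.
move=> st; rewrite mulmxA iwasawaM mulrN mulrC addrC [v * s]mulrC subrr.
by rewrite [t * s]mulrC st iwasawa1 mul1mx.
Qed.

(** For x written as upper triangular times rotation, [row_bot] controls the diagonal and [row_dot]
    the shear, while the rotation is free. The ranges suit scalings by powers of 2 and integer
    shears. *)
Definition tile (R : realType) : set 'cV[R]_4 :=
  [set x | [/\ X22 x, 1 <= row_bot x <= 4 & 0 <= row_dot x <= 4]].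

Lemma X22_closed (R : realType) : closed (@X22 R).
Proof.
have cc i : continuous (fun x : 'cV[R]_4 => x i 0) by exact: coord_continuous.
have cs i : continuous (fun x : 'cV[R]_4 => x i 0 ^+ 2).
  by move=> x; exact: continuousM (cc i x) (cc i x).
rewrite -[@X22 R]/((fun x : 'cV[R]_4 => x 0 0 ^+ 2 + x 1 0 ^+ 2 - x 2 0 ^+ 2 -
  x 3 0 ^+ 2) @^-1` [set y | y = 1]).
apply: preimage_closed; last exact: closed_eq.
move=> x _; exact: (continuousB (continuousB (continuousD (cs 0 x) (cs 1 x))
  (cs 2 x)) (cs 3 x)).
Qed.

Lemma tile_closed (R : realType) : closed (@tile R).
Proof.
have cc i : continuous (fun x : 'cV[R]_4 => x i 0) by exact: coord_continuous.
have cbot : continuous (@row_bot R).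
  move=> x; pose c31 := continuousB (cc 3 x) (cc 1 x).
  pose c02 := continuousB (cc 0 x) (cc 2 x).
  exact: (continuousD (continuousM c31 c31) (continuousM c02 c02)).
have cdot : continuous (@row_dot R).
  move=> x; pose c31 := continuousB (cc 3 x) (cc 1 x).
  pose c02 := continuousB (cc 0 x) (cc 2 x).
  exact: (continuousD (continuousM (continuousD (cc 0 x) (cc 2 x)) c31)
                      (continuousM (continuousD (cc 1 x) (cc 3 x)) c02)).
rewrite (_ : @tile R = @X22 R `&`
    ((@row_bot R @^-1` [set y | 1 <= y] `&`
      @row_bot R @^-1` [set y | y <= 4]) `&`
     (@row_dot R @^-1` [set y | 0 <= y] `&`
      @row_dot R @^-1` [set y | y <= 4]))).
  apply: closedI; first exact: X22_closed.
  have cl (F : 'cV[R]_4 -> R) u v : continuous F ->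
      closed (F @^-1` [set y | u <= y] `&` F @^-1` [set y | y <= v]).
    move=> cF; have cFA (A : set 'cV[R]_4) : {in A, continuous F}.
      by move=> x _; exact: cF.
    apply: closedI; first exact: (preimage_closed (cFA _) (@closed_ge _ u)).
    exact: (preimage_closed (cFA _) (@closed_le _ v)).
  by apply: closedI; exact: cl.
apply/seteqP; split=> x /=; first by case=> ? /andP[? ?] /andP[? ?].
by case=> ? [[? ?] [? ?]]; split=> //; exact/andP.
Qed.

Lemma tile_compact (R : realType) : compact (@tile R).
Proof.
apply: (@bounded_closed_compact_cV _ _ _ 21) => //; last exact: tile_closed.
move=> x i [xX /andP[b1 b4] /andP[d0 d4]].
have tb := row_top_bot xX.
(* [row_top] is (1 + [row_dot]^2) / [row_bot]; with [row_bot] at most 4, every squared coordinate is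
   at most 21. *)
have t17 : row_top x <= 17.
  have t0 : 0 <= row_top x by rewrite addr_ge0 ?sqr_ge0.
  by nra.
rewrite -(@ler_pXn2r _ 2) ?nnegrE ?normr_ge0//= real_normK ?num_real//.
have : x i 0 ^+ 2 <= row_top x + row_bot x.
  rewrite /row_top /row_bot.
  have : [\/ i = 0, i = 1, i = 2 | i = 3].
    case: i => -[|[|[|[|//]]]] ?; [exact/Or41/val_inj|exact/Or42/val_inj|
      exact/Or43/val_inj|exact/Or44/val_inj].
  by case=> ->; clear; nra.
lra.
Qed.

Lemma pow_bracket (R : realType) (r : R) (n : nat) :
  1 <= r <= 4 ^+ n.+1 -> exists2 j, (j <= n)%N & 4 ^+ j <= r <= 4 ^+ j.+1.
Proof.
elim: n => [|n IHn] /andP[r1 r4]; first by exists 0%N; rewrite // r1.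
have [rn|rn] := leP r (4 ^+ n.+1); last by exists n.+1; rewrite // (ltW rn).
by have [|j jn jr] := IHn; [rewrite r1|exists j; rewrite // leqW].
Qed.

(** A power of 2 brings [row_bot] into [1, 4]; an integer shear, which leaves [row_bot] alone, then
    brings [row_dot] between 0 and [row_bot]. The size bound limits both choices. *)
Lemma tile_cover (R : realType) (K : nat) (x : 'cV[R]_4) : (0 < K)%N ->
  X22 x -> row_top x + row_bot x <= 4 ^+ K ->
  exists j m : nat, [/\ (j < 2 * K)%N, (m <= 2 * 4 ^ K)%N &
    let s := 2 ^+ K / 2 ^+ j in
    exists2 y, tile y & x = iwasawa s s^-1 ((m%:R - 4 ^+ K) * s) *m y].
Proof.
move=> K0 xX; set N : R := 4 ^+ K => tbN.
have tb := row_top_bot xX; set p := row_dot x in tb *.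
have t0 : 0 <= row_top x by rewrite addr_ge0 ?sqr_ge0.
have b0 : 0 <= row_bot x by rewrite addr_ge0 ?sqr_ge0.
set q := row_bot x in tb tbN b0 *.
have N0 : 0 < N by rewrite exprn_gt0.
have pN : `|p| <= N.
  rewrite -(@ler_pXn2r _ 2) ?nnegrE ?normr_ge0 ?(ltW N0)//=.
  rewrite real_normK ?num_real//.
  by nra.
(* Since [row_top * row_bot] is at least 1 and both factors are at most [N], [N * q] lies in
   [1, 4^(2K)]: 2K exponents suffice. *)
have Nq1 : 1 <= N * q by nra.
have [j jK /andP[jl ju]] : exists2 j, (j <= (2 * K).-1)%N &
    4 ^+ j <= N * q <= 4 ^+ j.+1.
  apply: pow_bracket; rewrite Nq1 prednK ?muln_gt0// mul2n -addnn exprD -/N.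
  by rewrite ler_wpM2l ?(ltW N0)//; lra.
pose s : R := 2 ^+ K / 2 ^+ j.
have s0 : 0 < s by rewrite divr_gt0 ?exprn_gt0.
have s2 : s ^+ 2 = N / 4 ^+ j.
  have e4 : 2 ^+ 2 = 4 :> R by ring.
  by rewrite /s /N expr_div_n -!exprM !(mulnC _ 2%N) !exprM e4.
have sq : 1 <= s ^+ 2 * q <= 4.
  have j0 : 0 < 4 ^+ j :> R by rewrite exprn_gt0.
  by rewrite s2 mulrAC ler_pdivlMr// ler_pdivrMr// mul1r jl -exprS.
set Q := s ^+ 2 * q in sq; have /andP[Q1 Q4] := sq.
have pQ : `|p / Q| <= N.
  rewrite normrM normfV (ger0_norm (le_trans ler01 Q1)).
  rewrite ler_pdivrMr; last by lra.
  by nra.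
(* The integer part of [p / Q], shifted by [N] to be a natural number. *)
pose m := Num.truncn (p / Q + N).
have r0 : 0 <= p / Q + N by move: pQ; rewrite ler_norml; lra.
have /andP[ml mu] := truncn_itv r0.
exists j, m; split.
- by rewrite -[(2 * K)%N]prednK ?muln_gt0.
- rewrite -(ler_nat R) (le_trans ml)// natrM natrX -/N.
  by move: pQ; rewrite ler_norml; lra.
rewrite -/s /=; exists (iwasawa s^-1 s (- ((m%:R - N) * s)) *m x).
  split.
  - by apply: iwasawa_X22; rewrite ?mulVf ?gt_eqF.
  - by rewrite iwasawa_bot.
  - rewrite iwasawa_dot ?mulVf ?gt_eqF// -/p -/q.
    have -> : p + s * - ((m%:R - N) * s) * q = (p / Q - (m%:R - N)) * Q.
      rewrite [in RHS]mulrBl divfK ?lt0r_neq0// ?(lt_le_trans ltr01)// /Q.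
      by ring.
    rewrite mulr_ge0 /=; [|lra|lra].
    by rewrite (le_trans _ Q4)// ler_piMl//; move: mu; rewrite -natr1; lra.
by rewrite iwasawaK// mulfV ?gt_eqF.
Qed.

(** * Square integrability *)

(** On [D], [g] is dominated by the series of the c_k 1_{B_k}, whose integrals are bounded by the
    terms of a geometric series of sum [eps]. *)
Lemma integral_layers_le (d : measure_display) (T : measurableType d)
    (R : realType) (mu : {measure set T -> \bar R}) (D : set T) (g : T -> R)
    (B : (set T)^nat) (c : R^nat) (eps : R) :
  measurable D -> measurable_fun D g -> (forall x, D x -> 0 <= g x) ->
  (forall k, measurable (B k)) -> (forall k, 0 <= c k) -> 0 <= eps ->
  (forall x, D x -> exists2 k, B k x & g x <= c k) ->
  (forall k, ((c k)%:E * mu (B k) <= (eps / (2 ^ k.+1)%:R)%:E)%E) ->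
  (\int[mu]_(x in D) (g x)%:E <= eps%:E)%E.
Proof.
move=> mD mg g0 mB c0 eps0 gB cB.
pose h : nat -> T -> \bar R := fun k x => ((c k)%:E * (\1_(B k) x)%:E)%E.
have h0 k x : (0 <= h k x)%E by rewrite mule_ge0 ?lee_fin.
have mh k : measurable_fun D (h k).
  apply: measurable_funeM; apply/measurable_EFinP.
  by apply: measurable_indic.
apply: (@le_trans _ _ (\int[mu]_(x in D) (\sum_(k <oo) h k x))%E).
  apply: ge0_le_integral => //.
  - exact/measurable_EFinP.
  - by apply: ge0_emeasurable_sum => // k x _ _.
  - move=> x Dx; have [k Bkx gk] := gB x Dx.
    apply: (@le_trans _ _ (h k x)).
      by rewrite /h indicE mem_set// mule1 lee_fin.
    apply: (le_trans _ (nneseries_lim_ge k.+1 _)) => //.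
    by rewrite big_nat_recr//= leeDr// sume_ge0.
rewrite integral_nneseries//.
apply: le_trans (epsilon_trick0 xpredT eps0).
apply: lee_nneseries => [k _ _|k _].
  exact: integral_ge0.
apply: le_trans (cB k); rewrite /h ge0_integralZl_EFin//; last first.
  by apply/measurable_EFinP; exact: measurable_indic.
rewrite integral_indic// lee_wpmul2l ?lee_fin// le_measure ?inE//.
exact: measurableI.
Qed.

Definition zball (R : realType) (k : nat) : set (borel_cV R 4) :=
  [set x | X22 x /\ normc (zcoord x) ^+ 2 <= 4 ^+ k].

Lemma zball_measurable (R : realType) (k : nat) : measurable (@zball R k).
Proof.
apply: closed_measurable_cV; apply: closedI; first exact: X22_closed.
have cc i : continuous (fun x : 'cV[R]_4 => x i 0) by exact: coord_continuous.
apply: (@preimage_closed _ _ (fun x => normc (zcoord x) ^+ 2)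
  [set y | y <= 4 ^+ k]).
  under eq_fun do rewrite normc_zcoord.
  move=> x _; exact: (continuousD (continuousM (cc 0 x) (cc 0 x))
                                  (continuousM (cc 1 x) (cc 1 x))).
exact: closed_le.
Qed.

(** By invariance every covering translate has the mass of the tile, so it remains to count them.
    Here K = k + 1, because 4|z|^2 - 2 is at most 4^(k+1). *)
Lemma measure_zball_le (R : realType)
    (mu : {measure set (borel_cV R 4) -> \bar R}) (k : nat) :
  invariant_measure mu ->
  (mu (@zball R k) <= (48 * 8 ^+ k)%:E * mu (@tile R))%E.
Proof.
move=> [_ _ mu_inv]; pose K := k.+1; pose M := (2 * 4 ^ K).+1.
(* The pair (j, m) with m < [M] is encoded as the single index j [M] + m. *)
pose s (i : nat) : R := 2 ^+ K / 2 ^+ (i %/ M).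
have s0 i : 0 < s i by rewrite divr_gt0 ?exprn_gt0.
pose g i := iwasawa (s i) (s i)^-1 (((i %% M)%:R - 4 ^+ K) * s i).
pose A i : set (borel_cV R 4) := [set g i *m x | x in @tile R].
have mA i : measurable (A i).
  apply: closed_measurable_cV.
  apply: compact_closed; first exact: norm_hausdorff.
  apply: continuous_compact; last exact: tile_compact.
  exact/continuous_subspaceT/continuous_mulmxr.
have muA i : mu (A i) = mu (@tile R).
  apply: mu_inv; first exact: iwasawa_SO22o.
    by apply: closed_measurable_cV; exact: tile_closed.
  by move=> x [].
have sub : @zball R k `<=` \big[setU/set0]_(i < 2 * K * M) A i.
  move=> x [xX xk].
  have [] := @tile_cover R K x _ xX _ => //.
    by rewrite row_topD_bot// /K (exprS 4); lra.
  move=> j [m [jK mM [y ty xE]]]; rewrite -bigcup_mkord.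
  exists (j * M + m)%N => /=.
    rewrite (@leq_trans (j.+1 * M))// ?leq_mul2r ?jK ?orbT//.
    by rewrite mulSn addnC ltn_add2r ltnS.
  by exists y; rewrite // /g /s divnMDl// divn_small// addn0 modnMDl modn_small.
have : (mu (@zball R k) <= \sum_(i < 2 * K * M) mu (A i))%E.
  by apply: content_subadditive sub => //; exact: zball_measurable.
move/le_trans; apply.
rewrite (eq_bigr (fun=> mu (@tile R))) => [|i _]; last exact: muA.
rewrite (_ : \sum_(i < _) _ = (2 * K * M)%:R%:E * mu (@tile R))%E; last first.
  rewrite mule_natl; elim: (2 * K * M)%N => [|n IHn].
    by rewrite big_ord0 mule0n.
  by rewrite big_ord_recl IHn muleS.
rewrite lee_wpmul2r ?measure_ge0// lee_fin -[8]/(8%:R) -natrX -natrM ler_nat.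
(* The number of scales, linear in k, is absorbed into 2^k; this turns 4^k into 8^k. *)
have K2 : (K <= 2 * 2 ^ k)%N by rewrite -expnS ltnW// ltn_expl.
have M4 : (M <= 12 * 4 ^ k)%N.
  by rewrite /M /K expnS; have := expn_gt0 4 k; lia.
rewrite (@leq_trans (2 * (2 * 2 ^ k) * (12 * 4 ^ k)))//.
  by rewrite leq_mul// leq_mul2l.
by rewrite -[8%N]/(2 * 4)%N expnMn; lia.
Qed.

Lemma horner_zinv_measurable (R : realType) (p : {poly R[i]}) :
  measurable_fun setT
    ((fun x => complex.Re p.[(zcoord x)^-1]) : borel_cV R 4 -> R) /\
  measurable_fun setT
    ((fun x => complex.Im p.[(zcoord x)^-1]) : borel_cV R 4 -> R).
Proof.
have mc (i : 'I_4) : measurable_fun setT ((fun x => x i 0) : borel_cV R 4 -> R).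
  by apply: continuous_measurable_cV => //; exact: coord_continuous.
(* 1/z is conj(z) / |z|^2. The real power, like the inverse, is 0 at 0, so the formula also holds
   where z = 0. *)
pose n2 : borel_cV R 4 -> R := fun x => (x 0 0 ^+ 2 + x 1 0 ^+ 2) `^ (-1).
have mn2 : measurable_fun setT n2.
  have mn : measurable_fun setT
      ((fun x => x 0 0 ^+ 2 + x 1 0 ^+ 2) : borel_cV R 4 -> R).
    by apply: measurable_funD; apply: measurable_funX.
  exact: (measurableT_comp (measurable_powR (-1)) mn).
have n2E x : n2 x = (x 0 0 ^+ 2 + x 1 0 ^+ 2)^-1.
  by rewrite /n2 powR_inv1// addr_ge0 ?sqr_ge0.
elim/poly_ind: p => [|p c [IHr IHi]].
  by split; under eq_fun do rewrite horner0; exact: measurable_cst.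
have E x : p.[(zcoord x)^-1] * (zcoord x)^-1 + c =
    (complex.Re p.[(zcoord x)^-1] * (x 0 0 * n2 x) +
     complex.Im p.[(zcoord x)^-1] * (x 1 0 * n2 x) + complex.Re c) +i*
    (complex.Im p.[(zcoord x)^-1] * (x 0 0 * n2 x) -
     complex.Re p.[(zcoord x)^-1] * (x 1 0 * n2 x) + complex.Im c).
  rewrite n2E; case: (p.[_]) => a b; case: c => u v; rewrite /zcoord.
  by congr (_ +i* _); rewrite /=; ring.
split; under eq_fun do rewrite hornerMXaddC E/=.
  apply: measurable_funD => //; apply: measurable_funD;
    by apply: measurable_funM => //; apply: measurable_funM.
apply: measurable_funD => //; apply: measurable_funB;
  by apply: measurable_funM => //; apply: measurable_funM.
Qed.

Lemma horner_normc_bounded (R : realType) (p : {poly R[i]}) :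
  exists2 M, 0 <= M & forall u, normc u <= 1 -> normc p.[u] <= M.
Proof.
elim/poly_ind: p => [|p c [M M0 pM]].
  by exists 0 => // u _; rewrite horner0 normc0.
exists (M + normc c) => [|u u1]; first by rewrite addr_ge0 ?normc_ge0.
rewrite hornerMXaddC (le_trans (le_normcD _ _))// lerD2r normcM.
by rewrite -[M]mulr1 ler_pM ?normc_ge0 ?pM.
Qed.

Lemma horner_zinv_square_integrable (R : realType) (P : {poly R[i]})
    (mu : {measure set (borel_cV R 4) -> \bar R}) : invariant_measure mu ->
  square_integrable mu (fun x => ('X^2 * P).[(zcoord x)^-1]).
Proof.
move=> mu_inv; have [mRe mIm] := horner_zinv_measurable ('X^2 * P).
pose W (x : 'cV[R]_4) : R[i] := ('X^2 * P).[(zcoord x)^-1].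
have mX : measurable (@X22 R : set (borel_cV R 4)).
  by apply: closed_measurable_cV; exact: X22_closed.
have mReX : measurable_fun (@X22 R : set (borel_cV R 4))
    ((fun x => complex.Re (W x)) : borel_cV R 4 -> R).
  exact: measurable_funTS.
have mImX : measurable_fun (@X22 R : set (borel_cV R 4))
    ((fun x => complex.Im (W x)) : borel_cV R 4 -> R).
  exact: measurable_funTS.
split; [exact: mReX|exact: mImX|].
have nW x : normc (W x) ^+ 2 = complex.Re (W x) ^+ 2 + complex.Im (W x) ^+ 2.
  by case: (W x) => a b; rewrite sqr_sqrtr// addr_ge0 ?sqr_ge0.
have [M M0 PM] := horner_normc_bounded P.
have tE : mu (@tile R) = (fine (mu (@tile R)))%:E.
  rewrite fineK// ge0_fin_numE//; have [_ + _] := mu_inv.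
  by apply; [exact: tile_compact|by move=> x []].
set t := fine _ in tE.
have t0 : 0 <= t by rewrite fine_ge0.
(* With this constant as eps, c_k 48 8^k [t] is exactly eps / 2^(k+1). *)
apply: (@le_lt_trans _ _ (2 * (16 * M ^+ 2) * (48 * t))%:E).
  2: by rewrite ltry.
(* Where |z|^2 is at least 4^(k-1), |z|^-4 is at most 16 / 16^k, and |P(1/z)| is at most [M]. *)
pose c (k : nat) := 16 * M ^+ 2 / 16 ^+ k.
apply: (@integral_layers_le _ (borel_cV R 4) R mu (@X22 R)
  (fun x => normc (W x) ^+ 2) (@zball R) c); first exact: mX.
- under eq_fun do rewrite nW.
  by apply: measurable_funD; apply: measurable_funX.
- by move=> x _; rewrite sqr_ge0.
- exact: zball_measurable.
- by move=> k; rewrite divr_ge0 ?mulr_ge0 ?sqr_ge0 ?exprn_ge0.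
- by rewrite !mulr_ge0 ?sqr_ge0 ?ler0n.
- move=> x xX; have r1 := normc_zcoord_ge1 xX.
  set r := _ ^+ 2 in r1.
  have r0 : 0 < r := lt_le_trans ltr01 r1.
  (* A crude upper exponent starts the bracketing: r <= truncn r + 1 <= 4^(truncn r + 1). *)
  have [|j _ /andP[jl ju]] := @pow_bracket R r (Num.truncn r).
    rewrite r1/=; have /andP[_ /ltW/le_trans] := truncn_itv (ltW r0); apply.
    by rewrite -natrX ler_nat ltnW// ltn_expl.
  exists j.+1; first by split.
  have -> : normc (W x) ^+ 2 = r ^- 2 * normc P.[(zcoord x)^-1] ^+ 2.
    rewrite /W hornerM hornerXn normcM exprMn -exprVn; congr (_ ^+ 2 * _).
    by rewrite [(zcoord x)^-1 ^+ 2]expr2 normcM normcV -expr2 exprVn.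
  have u1 : normc (zcoord x)^-1 <= 1.
    have z0 := normc_gt0 (zcoord_neq0 xX).
    rewrite normcV invf_le1//.
    by rewrite -(@ler_pXn2r _ 2) ?nnegrE ?normc_ge0 ?ler01// expr1n.
  have PM2 : normc P.[(zcoord x)^-1] ^+ 2 <= M ^+ 2.
    by rewrite ler_pXn2r ?nnegrE ?normc_ge0 ?PM.
  clearbody r; have j0 : 0 < 4 ^+ j :> R by rewrite exprn_gt0.
  have -> : c j.+1 = (4 ^+ j) ^- 2 * M ^+ 2.
    have -> : 4 ^+ j ^+ 2 = 16 ^+ j :> R.
      by rewrite exprAC; congr (_ ^+ _); ring.
    rewrite /c (exprS 16); field.
    by rewrite expf_neq0.
  apply: ler_pM; [by rewrite invr_ge0 sqr_ge0|exact: sqr_ge0| |exact: PM2].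
  rewrite lef_pV2 ?posrE ?exprn_gt0//.
  by rewrite ler_pXn2r// nnegrE ltW.
- move=> k; apply: (@le_trans _ _ ((c k)%:E * ((48 * 8 ^+ k)%:E * t%:E))%E).
    rewrite lee_wpmul2l ?lee_fin ?divr_ge0 ?mulr_ge0 ?sqr_ge0 ?exprn_ge0//.
    by rewrite -tE measure_zball_le.
  rewrite -!EFinM lee_fin natrX /c -[16 ^+ k]/((_ : R) ^+ k).
  have -> : 16 ^+ k = 8 ^+ k * 2 ^+ k :> R.
    by rewrite -exprMn; congr (_ ^+ _); ring.
  rewrite (exprS 2) le_eqVlt; apply/orP; left; apply/eqP; field.
  by rewrite !expf_neq0.
Qed.
(** * Analyticity *)

(* [C] bounds both the coefficients and, geometrically, the remainders of the
   power series of [g] at 0. *)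
Definition geometric_series_at0 (R : rcfType) (g : R[i] -> R[i])
    (b : nat -> R[i]) (C rho : R) : Prop :=
  (forall k, normc (b k) <= C * rho ^+ k) /\
  (forall w N, rho * normc w <= 2^-1 ->
    normc (g w - \sum_(k < N) b k * w ^+ k) <= C * (rho * normc w) ^+ N).

(* Coefficients of g(w) / (z0 + w) when g(w) is the sum of the b_k w^k. *)
Fixpoint div_coef (R : rcfType) (z0 : R[i]) (b : nat -> R[i]) (k : nat) :
    R[i] :=
  if k is k'.+1 then (b k - div_coef z0 b k') / z0 else b 0%N / z0.

Lemma normc_exp (R : rcfType) (u : R[i]) (n : nat) :
  normc (u ^+ n) = normc u ^+ n.
Proof. by elim: n => [|n IHn]; rewrite ?normc1// !exprS normcM IHn. Qed.

Lemma le_normcB (R : rcfType) (u v : R[i]) : normc (u - v) <= normc u + normc v.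
Proof. by rewrite (le_trans (le_normcD _ _))// normcN. Qed.

(** Only the constant coefficient changes. [C] grows by |c| to cover it and the remainder at N = 0,
    where nothing is subtracted. *)
Lemma geometric_series_cst (R : rcfType) (g : R[i] -> R[i]) (c : R[i])
    (b : nat -> R[i]) (C rho : R) : 0 <= rho ->
  geometric_series_at0 g b C rho ->
  geometric_series_at0 (fun w => g w + c)
    (fun k => b k + (if k == 0%N then c else 0)) (C + normc c) rho.
Proof.
move=> rho0 [bC gC]; split=> [k|w N wr].
  rewrite (le_trans (le_normcD _ _))// mulrDl lerD//.
  case: k => [|k]; first by rewrite mulr1.
  by rewrite -[X in normc X]/(0 : R[i]) normc0 mulr_ge0 ?normc_ge0 ?exprn_ge0.

rewrite mulrDl; case: N => [|N].
  have := gC w 0%N wr; rewrite !big_ord0 !subr0 !mulr1 => g0.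
  by rewrite (le_trans (le_normcD _ _))// lerD2r.
have -> : g w + c -
      \sum_(k < N.+1) (b k + (if val k == 0%N then c else 0)) * w ^+ k =
    g w - \sum_(k < N.+1) b k * w ^+ k.
  rewrite !big_ord_recl/= !mulr1.
  under eq_bigr do rewrite addr0.
  by ring.
rewrite (le_trans (gC w N.+1 wr))// lerDl.
by rewrite mulr_ge0 ?normc_ge0// exprn_ge0// mulr_ge0 ?normc_ge0.
Qed.

(** The recurrence subtracts the previous coefficient and divides by z0; as rho |z0| is at least 2,
    C rho^k + C rho^k <= C rho^(k+1) |z0| closes the induction. *)
Lemma geometric_series_div (R : rcfType) (z0 : R[i]) (g : R[i] -> R[i])
    (b : nat -> R[i]) (C rho : R) : z0 != 0 -> 0 < rho ->
  2 <= rho * normc z0 ->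
  geometric_series_at0 g b C rho ->
  geometric_series_at0 (fun w => g w / (z0 + w)) (div_coef z0 b)
    (4 * C / normc z0) rho.
Proof.
move=> z00 rho0; have := normc_gt0 z00; set d := normc z0 => d0 rd [bC gC].
have C0 : 0 <= C.
  by have := bC 0%N; rewrite mulr1; apply: le_trans; exact: normc_ge0.
(* [div_coef] delayed by one index with 0 in front, so that one formula covers both cases of the
   recurrence. *)
pose e k := if k is k'.+1 then div_coef z0 b k' else 0.
have divE k : div_coef z0 b k = (b k - e k) / z0.
  by case: k => //=; rewrite subr0.
have e_le k : normc (e k) <= C * rho ^+ k.
  elim: k => [|k IHk]; first by rewrite [e 0%N]/= normc0 mulr1.
  rewrite [e _]divE normcM normcV -/d ler_pdivrMr//.
  rewrite (le_trans (le_normcB _ _))// (le_trans (lerD (bC k) IHk))//.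
  rewrite exprS; have := exprn_ge0 k (ltW rho0); set t := rho ^+ k => t0.
  have -> : C * (rho * t) * d = C * t * (rho * d) by ring.
  have -> : C * t + C * t = C * t * 2 by ring.
  by rewrite ler_wpM2l// mulr_ge0.
have nb_le k x : 0 <= x -> normc (b k - e k) * x <= 2 * C * rho ^+ k * x.
  move=> x0; rewrite ler_wpM2r// (le_trans (le_normcB _ _))//.
  by have := bC k; have := e_le k; lra.
split=> [k|w N wr].
  rewrite divE normcM normcV -/d mulrAC ler_wpM2r ?invr_ge0 ?(ltW d0)//.
  rewrite -[X in X <= _]mulr1 (le_trans (nb_le k 1 ler01))// mulr1.
  by have := exprn_ge0 k (ltW rho0); nra.
(* The product telescopes, leaving one boundary term. *)
have S_eq : (z0 + w) * (\sum_(k < N) div_coef z0 b k * w ^+ k) =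
    \sum_(k < N) b k * w ^+ k + e N * w ^+ N.
  elim: N => [|N IHN]; first by rewrite !big_ord0/= mulr0 mul0r addr0.
  rewrite !big_ord_recr/= mulrDr IHN divE exprS.
  by field.
(* |w| <= 1 / (2 rho) <= |z0| / 4, which keeps z0 + w away from 0. *)
have w4 : 4 * normc w <= d.
  by have := normc_ge0 w; nra.
have d2 : d / 2 <= normc (z0 + w).
  have : d <= normc (z0 + w) + normc w.
    by rewrite (le_trans _ (le_normcB _ _))// addrK.
  by have := normc_ge0 w; lra.
have zw0 : z0 + w != 0.
  by apply: contraTneq d2 => ->; rewrite normc0 -ltNge divr_gt0.
have -> : g w / (z0 + w) - \sum_(k < N) div_coef z0 b k * w ^+ k =
    (g w - \sum_(k < N) b k * w ^+ k - e N * w ^+ N) / (z0 + w).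
  apply: (mulfI zw0); rewrite mulrBr S_eq; by field.
rewrite normcM normcV ler_pdivrMr; last by rewrite normc_gt0.
set t := (rho * normc w) ^+ N.
have t0 : 0 <= t by rewrite exprn_ge0// mulr_ge0 ?normc_ge0 ?ltW.
apply: (@le_trans _ _ (2 * C * t)).
  rewrite (le_trans (le_normcB _ _))//.
  have h1 := gC w N wr.
  have h2 : normc (e N * w ^+ N) <= C * t.
    rewrite normcM normc_exp /t exprMn mulrA ler_wpM2r ?exprn_ge0 ?normc_ge0//.
  by move: h1; rewrite -/t; lra.
have -> : 2 * C * t = 4 * C / d * t * (d / 2) by field; rewrite gt_eqF.
by rewrite ler_wpM2l// mulr_ge0// divr_ge0 ?(ltW d0)// mulr_ge0.
Qed.

(** The disc of admissible [w] shrinks as the rate grows. This makes room for rho |z0| >= 2 before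
    each division. *)
Lemma geometric_series_le (R : rcfType) (g : R[i] -> R[i])
    (b : nat -> R[i]) (C rho rho' : R) : 0 <= rho -> rho <= rho' ->
  geometric_series_at0 g b C rho -> geometric_series_at0 g b C rho'.
Proof.
move=> rho0 rr [bC gC].
have C0 : 0 <= C.
  by have := bC 0%N; rewrite mulr1; apply: le_trans; exact: normc_ge0.
split=> [k|w N wr].
  by rewrite (le_trans (bC k))// ler_wpM2l// lerXn2r// nnegrE (le_trans rho0).
have ww : rho * normc w <= rho' * normc w by rewrite ler_wpM2r ?normc_ge0.
rewrite (le_trans (gC w N (le_trans ww wr)))// ler_wpM2l// lerXn2r// nnegrE.
  by rewrite mulr_ge0 ?normc_ge0.
by rewrite mulr_ge0 ?normc_ge0 ?(le_trans rho0).
Qed.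

Lemma horner_zinv_series (R : rcfType) (p : {poly R[i]}) (z0 : R[i]) :
  z0 != 0 -> exists b C rho, 0 < rho /\
    geometric_series_at0 (fun w => p.[(z0 + w)^-1]) b C rho.
Proof.
move=> z00; elim/poly_ind: p => [|p c [b [C [rho [rho0 pS]]]]].
  exists (fun=> 0), 0, 1; split=> //; split=> [k|w N _].
    by rewrite normc0 mul0r.
  rewrite horner0 big1 ?subr0 ?normc0 ?mul0r// => k _; exact: mul0r.
have d0 := normc_gt0 z00.
pose rho' := rho + 2 / normc z0.
have rr : rho <= rho' by rewrite lerDl divr_ge0 ?ltW.
have r'0 : 0 < rho' := lt_le_trans rho0 rr.
have r'2 : 2 <= rho' * normc z0.
  by rewrite mulrDl divfK ?gt_eqF// lerDr mulr_ge0 ?ltW.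
have := geometric_series_le (ltW rho0) rr pS.
move=> /(geometric_series_div z00 r'0 r'2).
move=> /(geometric_series_cst c (ltW r'0)) pcS.
do 3 eexists; split; first exact: r'0.
by under eq_fun do rewrite hornerMXaddC; exact: pcS.
Qed.

(** * From complex power series in z to real power series in four variables *)

(* The exponents (k - j, j, 0, 0): those of total degree k not involving the
   last two variables. *)
Definition expo2 (k : nat) (j : 'I_k.+1) : {ffun 'I_4 -> 'I_k.+1} :=
  [ffun i => if i == 0 then rev_ord j else if i == 1 then j else ord0].

Lemma expo2E (k : nat) (j : 'I_k.+1) :
  [/\ expo2 j 0 = rev_ord j, expo2 j 1 = j, expo2 j 2 = ord0
    & expo2 j 3 = ord0].
Proof. by split; rewrite ffunE. Qed.

Lemma big_ord4 (T : Type) (idx : T) (op : Monoid.law idx) (F : 'I_4 -> T) :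
  \big[op/idx]_i F i = op (op (op (F 0) (F 1)) (F 2)) (F 3).
Proof.
rewrite !big_ord_recr big_ord0 Monoid.mul1m.
by do !congr (op _ _); congr F; apply/val_inj.
Qed.

(** An exponent of degree k with last two entries 0 is determined by its second entry, which inverts
    [expo2]. *)
Lemma big_expo2 (R : realType) (k : nat) (G : {ffun 'I_4 -> 'I_k.+1} -> R) :
  (forall a : {ffun 'I_4 -> 'I_k.+1},
     (a 2 != 0%N :> nat) || (a 3 != 0%N :> nat) -> G a = 0) ->
  \sum_(a : {ffun 'I_4 -> 'I_k.+1} | (\sum_i (a i : nat))%N == k) G a =
  \sum_(j < k.+1) G (expo2 j).
Proof.
move=> G0; rewrite (bigID (fun a : {ffun 'I_4 -> 'I_k.+1} =>
  (a 2 == 0%N :> nat) && (a 3 == 0%N :> nat))) /= [X in _ + X]big1 ?addr0.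
  2: by move=> a /andP[_]; rewrite negb_and; exact: G0.
rewrite (reindex_onto (@expo2 k) (fun a => a 1)); last first.
  move=> a /andP[]; rewrite big_ord4/= => /eqP ak /andP[/eqP a2 /eqP a3].
  apply/ffunP => i; apply/val_inj; rewrite ffunE.
  have : [\/ i = 0, i = 1, i = 2 | i = 3].
    case: i => -[|[|[|[|//]]]] ?; [exact/Or41/val_inj|exact/Or42/val_inj|
      exact/Or43/val_inj|exact/Or44/val_inj].
  case=> ->; rewrite /= ?a2 ?a3//.
  by rewrite subSS -[X in (X - _)%N]ak a2 a3 !addn0 addnK.
apply: eq_bigl => j; rewrite big_ord4 !ffunE/= subSS !addn0 subnK ?eqxx//.
by rewrite -ltnS.
Qed.

(* Expands L(sum_k b_k (h_1 + i h_2)^k) in the variables h_1, ..., h_4. *)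
Definition series_coef (R : realType) (L : R[i] -> R) (b : nat -> R[i])
    (a : 'I_4 -> nat) : R :=
  if (a 2 == 0%N) && (a 3 == 0%N) then
    L (b (a 0%R + a 1%R)%N * ('C(a 0%R + a 1%R, a 1%R)%:R * 'i ^+ a 1%R))
  else 0.

Lemma normc_real (R : rcfType) (x : R) : normc x%:C = `|x|.
Proof. by rewrite /normc/= expr0n/= addr0 sqrtr_sqr. Qed.

Lemma normc_i (R : rcfType) : normc ('i : R[i]) = 1.
Proof. by rewrite /normc/= expr0n expr1n add0r sqrtr1. Qed.

Lemma zcoordE (R : realType) (h : 'cV[R]_4) :
  zcoord h = (h 0 0)%:C + (h 1 0)%:C * 'i.
Proof. by rewrite /zcoord; simpc. Qed.

(* Instances: the real and the imaginary part. *)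
Definition real_projection (R : rcfType) (L : R[i] -> R) : Prop :=
  [/\ forall u v, L (u + v) = L u + L v,
      forall u (x : R), L (u * x%:C) = L u * x
    & forall u, `|L u| <= normc u].

Lemma real_projection0 (R : rcfType) (L : R[i] -> R) :
  real_projection L -> L 0 = 0.
Proof. by move=> [_ LZ _]; have := LZ 0 0; rewrite mul0r mulr0. Qed.

Lemma real_projection_sum (R : rcfType) (L : R[i] -> R) (I : Type) (r : seq I)
    (F : I -> R[i]) :
  real_projection L -> L (\sum_(i <- r) F i) = \sum_(i <- r) L (F i).
Proof.
move=> LP; have [LD _ _] := LP.
exact: (big_morph L LD (real_projection0 LP)).
Qed.

Lemma coord_le_norm (R : realType) (n : nat) (h : 'cV[R]_n) (i : 'I_n) :
  `|h i 0| <= `|h|.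
Proof.
rewrite [leRHS]/Num.norm/= mx_normrE.
by apply/bigmax_geP; right; exists (i, 0).
Qed.

Lemma series_coef_term (R : realType) (L : R[i] -> R) (b : nat -> R[i])
    (h : 'cV[R]_4) (k : nat) (j : 'I_k.+1) :
  series_coef L b (fun i => expo2 j i) * \prod_i h i 0 ^+ expo2 j i =
  L (b k * ('C(k, j)%:R * 'i ^+ j)) * (h 0 0 ^+ (k - j) * h 1 0 ^+ j).
Proof.
have [e0 e1 e2 e3] := expo2E j.
rewrite /series_coef big_ord4 e0 e1 e2 e3 !expr0 /= subSS !mulr1.
by rewrite subnK// -ltnS.
Qed.

(** The binomial expansion of (h_1 + i h_2)^k, pushed through the real-linear [L]. *)
Lemma homog_part_series (R : realType) (L : R[i] -> R) (b : nat -> R[i])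
    (h : 'cV[R]_4) (k : nat) : real_projection L ->
  homog_part (series_coef L b) h k = L (b k * zcoord h ^+ k).
Proof.
move=> LP; have [_ LZ _] := LP.
rewrite /homog_part big_expo2 => [|a a23]; last first.
  by rewrite /series_coef ifN ?negb_and// mul0r.
rewrite zcoordE exprDn mulr_sumr real_projection_sum//; apply: eq_bigr => j _.
rewrite series_coef_term -LZ; congr L.
by rewrite rmorphM !rmorphXn/= exprMn -mulr_natl; ring.
Qed.

(** Powers of i have modulus 1 and |h_1|, |h_2| <= |h|, so the binomial sum is at most (|h| +
    |h|)^k. *)
Lemma homog_part_abs_series_le (R : realType) (L : R[i] -> R)
    (b : nat -> R[i]) (h : 'cV[R]_4) (k : nat) : real_projection L ->
  homog_part_abs (series_coef L b) h k <= normc (b k) * (2 * `|h|) ^+ k.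
Proof.
move=> [_ _ Lle]; rewrite /homog_part_abs big_expo2 => [|a a23]; last first.
  by rewrite /series_coef ifN ?negb_and// mul0r normr0.
rewrite mulr2n mulrDl mul1r exprDn mulr_sumr; apply: ler_sum => j _.
rewrite series_coef_term normrM (le_trans (ler_wpM2r _ (Lle _)))//.
rewrite normcM -mulrA ler_wpM2l ?normc_ge0//.
rewrite normcM normc_exp normc_i expr1n mulr1.
rewrite -[_%:R]/(_%:R) -(rmorph_nat (real_complex R)) normc_real normr_nat.
rewrite -[leRHS]mulr_natl ler_wpM2l// normrM !normrX.
by apply: ler_pM; rewrite ?exprn_ge0// lerXn2r ?nnegrE ?coord_le_norm.
Qed.

Lemma series_real_analytic (R : realType) (L : R[i] -> R)
    (g : R[i] -> R[i]) (b : nat -> R[i]) (C rho : R)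
    (F : 'cV[R]_4 -> R) (x : 'cV[R]_4) :
  real_projection L -> 0 < rho -> geometric_series_at0 g b C rho ->
  (forall h, F (x + h) = L (g (zcoord h))) ->
  real_analytic_at F x.
Proof.
move=> LP rho0 [bC gC] FE; have [LD LZ Lle] := LP.
(* Within this radius 2 rho |h| <= 1/2, and |z(h)| <= 2|h|; absolute terms and remainders are then
   both bounded by C 2^-k. *)
exists (series_coef L b), (4 * rho)^-1.
split=> [|h hr]; first by rewrite invr_gt0 mulr_gt0.
have C0 : 0 <= C.
  by have := bC 0%N; rewrite mulr1; apply: le_trans; exact: normc_ge0.
have rh : rho * (2 * `|h|) <= 2^-1.
  move: hr; rewrite -[_^-1]mul1r ltr_pdivlMr ?mulr_gt0// => hr; lra.
have rz : rho * normc (zcoord h) <= 2^-1.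
  apply: le_trans rh; rewrite ler_wpM2l ?(ltW rho0)//.
  rewrite zcoordE (le_trans (le_normcD _ _))// normcM normc_i mulr1 !normc_real.
  by rewrite mulr_natl mulr2n lerD ?coord_le_norm.
split.
  apply: (@series_le_cvg _ _ (geometric C 2^-1)).
  - by move=> k; rewrite /homog_part_abs sumr_ge0.
  - by move=> k; rewrite /= mulr_ge0 ?exprn_ge0 ?invr_ge0.
  - move=> k; rewrite (le_trans (homog_part_abs_series_le _ _ _ LP))//=.
    rewrite (le_trans (ler_wpM2r _ (bC k))) ?exprn_ge0 ?mulr_ge0//.
    rewrite -mulrA -exprMn ler_wpM2l// lerXn2r ?nnegrE ?invr_ge0//.
    by rewrite !mulr_ge0// ltW.
  - apply: is_cvg_geometric_series.
    by rewrite ger0_norm ?invr_ge0// invf_lt1// ltr1n.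
have cvg0 : geometric C 2^-1 @ \oo --> 0.
  by apply: cvg_geometric; rewrite ger0_norm ?invr_ge0// invf_lt1// ltr1n.
apply/cvgrPdist_le => e e0.
have /cvgrPdist_le/(_ e e0) := cvg0; apply: filterS => N /=.
rewrite sub0r normrN => gN.
rewrite /series/= (eq_bigr (fun k => L (b k * zcoord h ^+ k))); last first.
  by move=> k _; exact: homog_part_series.
rewrite FE -(real_projection_sum _ _ LP) -mulN1r -[-1]/(-1) big_mkord.
have LN u : - L u = L (- u).
  by apply/eqP; rewrite eq_sym -addr_eq0 -LD addNr real_projection0.
rewrite mulN1r LN -LD (le_trans (Lle _))// (le_trans (gC _ N rz))//.
rewrite (le_trans _ gN)// (le_trans _ (ler_norm _))//= ler_wpM2l//.
by rewrite lerXn2r ?nnegrE ?invr_ge0// mulr_ge0 ?normc_ge0// ltW.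
Qed.

(** * The interpolating polynomial *)

Lemma interpolating_poly (R : realType) (n : nat) (D : n.-tuple 'cV[R]_4)
    (f : 'cV[R]_4 -> rat) :
  (forall x, x \in D -> X22Q x) -> {in D &, injective (@phi R 1)} ->
  exists P : {poly R[i]}, [/\ (size P <= n)%N,
    forall i, gaussian_rational P`_i
    & forall x, x \in D -> ('X^2 * P).[(zcoord x)^-1] = (ratr (f x))%:C].
Proof.
move=> DQ phiI.
have Du x : x \in D -> exists u : rat[i], ratrC R u = (zcoord x)^-1.
  move=> /DQ[_ [q ->]]; exists (q 0 0 +i* q 1 0)^-1.
  by rewrite fmorphV /zcoord !mxE.
have [u uE] : exists u : 'cV[R]_4 -> rat[i],
    forall x, x \in D -> ratrC R (u x) = (zcoord x)^-1.
  (* Choice produces a total function; outside [D] the value 0 is a placeholder. *)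
  have /choice[u uE] : forall x, exists u : rat[i],
      x \in D -> ratrC R u = (zcoord x)^-1.
    move=> x; have [/Du[u uE]|_] := boolP (x \in D); last by exists 0.
    by exists u.
  by exists u.
have uI : {in D &, injective u}.
  move=> x y xD yD uxy; apply: phiI => //.
  have phi1E (z : 'cV[R]_4) : phi 1 z = (zcoord z)^-1 by [].
  by rewrite !phi1E -(uE x)// -(uE y)// uxy.
(* [v] looks up a point of [D] with node [w], which is the right one by injectivity of [u]; dividing
   by w^2 offsets ['X^2]. *)
pose v (w : rat[i]) := (f (nth 0 D (index w (map u D))))%:C / w ^+ 2.
have vE x : x \in D -> v (u x) = (f x)%:C / u x ^+ 2.
  move=> xD; congr ((f _)%:C / _).
  have iD : (index (u x) (map u D) < size D)%N.
    by rewrite -(size_map u) index_mem map_f.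
  apply: uI => //; first exact: mem_nth.
  by rewrite -(nth_map 0 (u 0)) ?nth_index ?map_f.
have [P szP Pv] := newton_interpolation (map u D) v.
exists (map_poly (ratrC R) P); split.
- by rewrite size_map_poly (leq_trans szP)// size_map size_tuple.
- by move=> i; rewrite coef_map/=; exists (complex.Re P`_i), (complex.Im P`_i).
- move=> x xD; have ux0 : u x != 0.
    have [/zcoord_neq0 + _] := DQ _ xD.
    rewrite -invr_eq0 -uE//; apply: contra_neq => ->; exact: rmorph0.
  rewrite hornerM hornerXn -uE// horner_map/= Pv ?map_f// vE//.
  rewrite -rmorphXn -rmorphM/= mulrC divfK ?expf_neq0//.
  by rewrite /ratrC/= rmorph0.
Qed.

(** * K-finiteness *)

Lemma SO2P (R : realType) (k : 'M[R]_2) : SO2 k ->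
  [/\ k^T *m k = 1%:M, k 1 1 = k 0 0 & k 1 0 = - k 0 1].
Proof.
(* Transpose and adjugate are both the inverse; comparing their entries gives the shape of a
   rotation. *)
move=> [kk detk]; have kE : k^T = \adj k.
  by rewrite -[RHS]mul1mx -kk -mulmxA mul_mx_adj detk mulmx1.
split=> //.
- have /matrixP/(_ 1 1) := kE; rewrite !mxE /cofactor det_mx11 !mxE/=.
  have -> : lift 1 0 = 0 :> 'I_2 by apply/val_inj.
  by rewrite -signr_odd/= mul1r.
- have /matrixP/(_ 0 1) := kE; rewrite !mxE /cofactor det_mx11 !mxE/=.
  have -> : lift 1 0 = 0 :> 'I_2 by apply/val_inj.
  have -> : lift 0 0 = 1 :> 'I_2 by apply/val_inj.
  by rewrite -signr_odd/= mulN1r.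
Qed.

Lemma SO2xSO2_zcoord (R : realType) (k : 'M[R]_4) : SO2xSO2 k ->
  exists w : R[i], forall x, zcoord (invmx k *m x) = w * zcoord x.
Proof.
case=> [k1 [k2 [/SO2P[k1k1 k11 k10] /SO2P[k2k2 _ _] ->{k}]]].
set k := block_mx k1 0 0 k2.
have kk : k^T *m k = 1%:M.
  rewrite tr_block_mx mulmx_block !trmx0 !mul0mx !mulmx0 k1k1 k2k2 !addr0 add0r.
  by rewrite -scalar_mx_block.
have -> : invmx k = k^T.
  by rewrite -[RHS]mulmx1 -(mulmxV (mulmx1_unit kk).2) mulmxA kk mul1mx.
(* The inverse rotation multiplies z by the conjugate of the number in the first column of [k1]. *)
exists (k1 0 0 -i* k1 1 0) => x.
have e0 : 0 = lshift 2 (0 : 'I_2) :> 'I_4 by apply/val_inj.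
have e1 : 1 = lshift 2 (1 : 'I_2) :> 'I_4 by apply/val_inj.
have kx (j : 'I_2) :
    (k^T *m x) (lshift 2 j) 0 = k1 0 j * x 0 0 + k1 1 j * x 1 0.
  rewrite tr_block_mx !trmx0 mxE big_split_ord/= [X in _ + X]big1 ?addr0.
    rewrite !big_ord_recl big_ord0 addr0 !block_mxEul !mxE e0 e1.
    by congr (_ * _ + k1 _ _ * x _ _); apply/val_inj.
  by move=> i _; rewrite block_mxEur mxE mul0r.
rewrite /zcoord e0 e1 !kx -e0 -e1 k11 k10; simpc.
by congr (_ +i* _); ring.
Qed.

(** Each phi_l is an eigenvector with eigenvalue w^-l, so all translates stay in the span of phi_2,
    ..., phi_(n+1). *)
Lemma Wfun_K_finite (R : realType) (n : nat) (a : nat -> R[i]) :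
  K_finite (Wfun n a).
Proof.
exists n, (fun j => @phi R (j + 2)) => k /SO2xSO2_zcoord[w wE].
exists (fun j => a (j + 2)%N * w ^- (j + 2)) => x _.
rewrite /Wfun -{1}[2%N]add0n big_addn -addn2 addnK big_mkord.
apply: eq_bigr => j _; rewrite -mulrA; congr (_ * _).
by rewrite /phi -!/(zcoord _) wE exprMn invfM.
Qed.

(** The formula is its own ambient extension: its expansion around z(x) composes with the additive
    map h |-> z(h). *)
Lemma horner_zinv_analytic (R : realType) (p : {poly R[i]}) :
  analytic_on (@X22 R) (fun x => p.[(zcoord x)^-1]).
Proof.
have Le (u : R[i]) : `|complex.Re u| <= normc u /\ `|complex.Im u| <= normc u.
  case: u => a b; rewrite /normc -!sqrtr_sqr !ler_sqrt ?addr_ge0 ?sqr_ge0//.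
  by rewrite lerDl lerDr !sqr_ge0.
have zD (x h : 'cV[R]_4) : zcoord (x + h) = zcoord x + zcoord h.
  by rewrite /zcoord !mxE.
have ReP : real_projection (@complex.Re R).
  split=> [[a c] [d e]//|[a c] d|u]; last exact: (Le u).1.
  by rewrite /= mulr0 subr0.
have ImP : real_projection (@complex.Im R).
  split=> [[a c] [d e]//|[a c] d|u]; last exact: (Le u).2.
  by rewrite /= mulr0 add0r.
split=> x /zcoord_neq0/(horner_zinv_series p)[b [C [rho [rho0 pS]]]].
  exists (fun y => complex.Re p.[(zcoord y)^-1]); split.
    2: by apply: (@nearW _ (nbhs x)).
  apply: (series_real_analytic ReP rho0 pS) => h.
  exact: (congr1 (fun w => complex.Re p.[w^-1]) (zD x h)).
exists (fun y => complex.Im p.[(zcoord y)^-1]); split.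
  2: by apply: (@nearW _ (nbhs x)).
apply: (series_real_analytic ImP rho0 pS) => h.
exact: (congr1 (fun w => complex.Im p.[w^-1]) (zD x h)).
Qed.

Theorem theorem1p2 (R : realType) (n : nat) (D : n.-tuple 'cV[R]_4)
    (f : 'cV[R]_4 -> rat)
    (D_rational : forall x, x \in D -> X22Q x)
    (f_nonconstant : ~ exists c : rat, forall x, x \in D -> f x = c)
    (phi1_injective : {in D &, injective (@phi R 1)}) :
  exists a : nat -> R[i],
    (forall l, (2 <= l <= n.+1)%N -> gaussian_rational (a l)) /\
    [/\ analytic_on (@X22 R) (Wfun n a),
        forall mu : {measure set (borel_cV R 4) -> \bar R},
          invariant_measure mu -> square_integrable mu (Wfun n a),
        K_finite (Wfun n a)
      & forall x, x \in D -> Wfun n a x = (ratr (f x))%:C].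
Proof.
have [P [szP Pgauss Pf]] := interpolating_poly f D_rational phi1_injective.
(* Indices l < 2, where the subtraction truncates, never enter the sum. *)
exists (fun l => P`_(l - 2)); split=> [l _|]; first exact: Pgauss.
have WE : Wfun n (fun l => P`_(l - 2)) = fun x => ('X^2 * P).[(zcoord x)^-1].
  by apply/funext => x; exact: Wfun_horner.
split; last by move=> x xD; rewrite WE Pf.
- by rewrite WE; exact: horner_zinv_analytic.
- by move=> mu mu_inv; rewrite WE; exact: horner_zinv_square_integrable.
- exact: Wfun_K_finite.
Qed.
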